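(* Let $T_1,T_2,X\in\mathcal{B}(\mathcal{H})$ be any contractions such that $T_1X=XT_2$. Then there are Hilbert spaces $\mathcal{K}_1,\mathcal{K}_2\supseteq\mathcal{H}$, co-isometric extensions $Z_i\in\mathcal{B}(\mathcal{K}_i)$ of $T_i$ for $i=1,2$, and a co-isometric extension $R\in\mathcal{B}(\mathcal{K}_2,\mathcal{K}_1)$ of $X$ such that $Z_1R=RZ_2$.
   Context: All Hilbert spaces are complex; $\mathcal{B}(\mathcal{H})$ is the algebra of bounded linear operators on $\mathcal{H}$; containment of Hilbert spaces means containment as a closed linear subspace; a contraction is an operator of norm at most one. $B\in\mathcal{B}(\mathcal{K})$ is an extension of $A\in\mathcal{B}(\mathcal{H})$, $\mathcal{H}\subseteq\mathcal{K}$, if $Bh=Ah$ for all $h\in\mathcal{H}$. Similarly $R\in\mathcal{B}(\mathcal{K}_2,\mathcal{K}_1)$ is an extension of $X\in\mathcal{B}(\mathcal{H})$ if $Rh=Xh$ for all $h\in\mathcal{H}$, where $\mathcal{H}$ is regarded as a subspace of both $\mathcal{K}_2$ and $\mathcal{K}_1$. An extension is co-isometric if its adjoint is an isometry (i.e. $BB^*=I_{\mathcal{K}}$, resp. $RR^*=I_{\mathcal{K}_1}$). *)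

(* Defs.v *)
From HB Require Import structures.
From mathcomp Require Import all_boot all_order all_algebra.
From mathcomp Require Import sesquilinear.
From mathcomp Require Import all_classical all_reals all_analysis.
From mathcomp Require Import complex.

Set Implicit Arguments.
Unset Strict Implicit.
Unset Printing Implicit Defensive.
Import Order.TTheory GRing.Theory Num.Theory.
Import numFieldNormedType.Exports.
Local Open Scope classical_set_scope.
Local Open Scope ring_scope.

(* The inner product is linear in its first argument and conjugate-linear in
   the second; positive definiteness is part of {dot _ for _}. *)
Record hilbertType (R : realType) := Hilbert {
  hilbert_sort :> completeNormedModType R[i];
  hdot : {dot hilbert_sort for (@Num.conj R[i])};
  hdotE : forall x : hilbert_sort, hdot x x = `|x| ^+ 2 }.

Arguments hdot {R} h.

Record boundedOp (R : realType) (H K : hilbertType R) := BoundedOp {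
  bop_linear :> {linear H -> K};
  bopP : bounded_near bop_linear (nbhs (0 : H)) }.

Section Operators.
Context {R : realType}.
Implicit Types H K : hilbertType R.

(* The norm on H takes values in R[i] (on the nonnegative reals), hence Re. *)
Definition opnorm H K (T : boundedOp H K) : \bar R :=
  ereal_sup [set (complex.Re `|T x|)%:E | x in [set x : H | `|x| <= 1]].

Definition contractive H K (T : boundedOp H K) : Prop := (opnorm T <= 1)%E.

Definition is_adjoint H K (T : boundedOp H K) (Ts : boundedOp K H) : Prop :=
  forall (x : H) (y : K), hdot K (T x) y = hdot H x (Ts y).

Lemma is_adjoint_uniq H K (T : boundedOp H K) (S1 S2 : boundedOp K H) :
  is_adjoint T S1 -> is_adjoint T S2 -> S1 =1 S2.
Proof.
move=> a1 a2 y; apply/eqP; rewrite -subr_eq0; apply/eqP.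
set d := S1 y - S2 y.
have d0 : hdot H d d = 0 by rewrite {2}/d linearBr/= -a1 -a2 subrr.
by apply/normr0_eq0/eqP; rewrite -sqrf_eq0 -hdotE d0.
Qed.

Definition coisometric H K (T : boundedOp H K) : Prop :=
  exists2 Ts : boundedOp K H,
    is_adjoint T Ts & isometry (hdot H) (hdot K) Ts.

End Operators.

(* A realization of H as a closed linear subspace of K: [embed] plays the role
   of the inclusion map, so that its image is identified with H. *)
Record hilbertSub (R : realType) (H K : hilbertType R) := HilbertSub {
  embed :> {linear H -> K};
  embed_isometry : isometry (hdot K) (hdot H) embed;
  embed_closed : closed (range embed) }.

(* B : K2 -> K1 extends A : H -> H, with H seen inside K2 via J2 and inside K1
   via J1. *)
Definition is_extension (R : realType) (H K2 K1 : hilbertType R)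
    (J2 : hilbertSub H K2) (J1 : hilbertSub H K1)
    (A : boundedOp H H) (B : boundedOp K2 K1) : Prop :=
  forall h : H, B (J2 h) = J1 (A h).

(* Main.v *)
From HB Require Import structures.
Require Import Defs.
From mathcomp Require Import all_boot all_order all_algebra.
From mathcomp Require Import sesquilinear complex.
From mathcomp Require Import all_classical all_reals all_analysis.
From mathcomp Require Import ring lra.
Set Implicit Arguments.
Unset Strict Implicit.
Unset Printing Implicit Defensive.
Import Order.TTheory GRing.Theory Num.Theory.
Import numFieldNormedType.Exports.
Local Open Scope classical_set_scope.
Local Open Scope ring_scope.

(** Passing to adjoints, the theorem asks for isometric dilations: with
    A1, A2, B the adjoints of T1, T2, X, so that B A1 = A2 B, one looks for
    isometries V1 on K1, V2 on K2 and W : K1 -> K2, compressing to A1, A2 and B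
    along the projections onto H, with V2 W = W V1.  Their adjoints are the
    required co-isometric extensions.

    The intertwiner W goes from K1 to K2, which leaves room for K2 to be chosen
    after K1, and this is what makes a short construction possible
    ([isometric_intertwining]).  Let V1 be any isometric dilation of A1, and
    complete B P1, where P1 projects K1 onto H, to an isometry
    W0 = (B P1, D) : K1 -> M, where M is the sum of H and of copies of the
    target E of D, and D^* D = 1 - (B P1)^* (B P1).  On the range of W0 the
    operator V2 has to be the isometry W0 k |-> W0 (V1 k), whose first component
    is A2 applied to the first component of W0 k.  So one wants a contraction
    T = (A2 P0, Gam D2) on M, where P0 : M -> H is the projection
    and D2^* D2 = 1 - (A2 P0)^* (A2 P0), with Gam D2 W0 = D V1.  Such a
    contraction Gam exists by Douglas' lemma ([factorization]), since D2 W0 k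
    and D (V1 k) have the same norm: both squared norms are
    |k|^2 - |A2 B P1 k|^2.  Finally let V2 be the isometric dilation of T
    ([isometric_dilation]).  It agrees with T wherever T is isometric already,
    in particular on the range of W0, whence V2 W0 = W0 V1.

    The Hilbert space theory behind this consists of countable direct sums
    ([hilbert_sum]), a representation theorem for functionals that gives both
    adjoints and Douglas' lemma ([riesz_representation]), and defect operators
    ([defect_operator]).  The latter take values in the sum of countably many
    copies of the space, which avoids the square root of a positive operator. *)

(** * Real and imaginary parts *)

Section ComplexParts.
Variable R : realType.
Implicit Types (z : R[i]) (r t : R).

Lemma Re_mulr t z : complex.Re (t%:C%C * z) = t * complex.Re z.
Proof. by case: z => a b /=; rewrite mul0r subr0. Qed.

Lemma Re_mulNi z : complex.Re (- 'i%C * z) = complex.Im z.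
Proof. by case: z => a b /=; rewrite oppr0 mul0r mulN1r sub0r opprK. Qed.

Lemma Re_norm_le z r : `|z| <= r%:C%C -> `|complex.Re z| <= r.
Proof. by move=> h; rewrite -lecR; apply: le_trans h; exact: normc_ge_Re. Qed.

Lemma Im_norm_le z r : `|z| <= r%:C%C -> `|complex.Im z| <= r.
Proof.
move=> h; rewrite -Re_mulNi; apply: Re_norm_le.
by rewrite normrM normrN complexiE normCi mul1r.
Qed.

End ComplexParts.

(** * Positive definite forms *)

Section DotForms.
Variables (C : numClosedFieldType) (U : lmodType C).
Variable form : {dot U for @Num.conj C}.
Implicit Types u v w : U.

Lemma dotC u v : form u v = (form v u)^*.
Proof. by rewrite hermC expr0 mul1r. Qed.

Lemma dotZl a u v : form (a *: u) v = a * form u v.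
Proof. exact: linearZl_LR. Qed.

Lemma dotZr a u v : form u (a *: v) = a^* * form u v.
Proof. exact: linearZr_LR. Qed.

Lemma dotPl a u v w : form (a *: u + v) w = a * form u w + form v w.
Proof. exact: linearPl. Qed.

Lemma dot_CauchySchwarz u v : `|form u v| ^+ 2 <= form u u * form v v.
Proof.
have [->|v0] := eqVneq v 0.
  by rewrite linear0r normr0 expr0n/= linear0r mulr0.
have vv0 : 0 < form v v by rewrite dnorm_gt0.
(* a multiple of the component of u orthogonal to v *)
have := dnorm_ge0 form (form v v *: u - form u v *: v).
rewrite dnormB !dnormZ dotZl dotZr (gtr0_norm vv0).
have : (form v v)^* = form v v by rewrite -dotC.
move: (form u u) (form u v) (form v v) vv0 => a b c c0 cJ.
rewrite !rmorphM /= conjCK cJ normCK.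
rewrite (_ : _ - _ = c * (a * c - b * b^*)); last by ring.
by rewrite pmulr_rge0// subr_ge0.
Qed.

Definition dotnorm u := sqrtC (form u u).

Lemma sqr_dotnorm u : dotnorm u ^+ 2 = form u u.
Proof. exact: sqrtCK. Qed.

Lemma dotnorm_ge0 u : 0 <= dotnorm u.
Proof. by rewrite sqrtC_ge0 dnorm_ge0. Qed.

Lemma dotnormD u v : dotnorm (u + v) <= dotnorm u + dotnorm v.
Proof.
rewrite -ler_sqr ?nnegrE ?addr_ge0 ?dotnorm_ge0//.
rewrite sqrrD !sqr_dotnorm dnormD addrAC lerD2r lerD2l.
have d1 : `|form u v| <= dotnorm u * dotnorm v.
  rewrite -ler_sqr ?nnegrE ?mulr_ge0 ?dotnorm_ge0//.
  by rewrite exprMn !sqr_dotnorm dot_CauchySchwarz.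
rewrite (le_trans (real_ler_norm _)) ?(le_trans (ler_normD _ _))//.
  by rewrite CrealE rmorphD /= conjCK addrC.
by rewrite norm_conjC -mulr2n lerMn2r.
Qed.

Lemma dotnormZ a u : dotnorm (a *: u) = `|a| * dotnorm u.
Proof. by rewrite /dotnorm dnormZ rootCMl ?exprn_ge0// sqrCK. Qed.

Lemma dotnorm0_eq0 u : dotnorm u = 0 -> u = 0.
Proof. by move=> /eqP; rewrite sqrt_dnorm_eq0 => /eqP. Qed.

End DotForms.

(** * Limits of complex numbers *)

Lemma cvg_complex (R : realType) (u : nat -> R[i]) :
  cvgn (fun n => complex.Re (u n)) -> cvgn (fun n => complex.Im (u n)) ->
  (u : nat -> R[i]^o) @ \oo -->
    (Complex (limn (fun n => complex.Re (u n)))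
             (limn (fun n => complex.Im (u n))) : R[i]^o).
Proof.
move=> cr ci; apply/cvgrPdist_lt => e e0.
have eE : e = (complex.Re e)%:C%C by rewrite RRe_real// gtr0_real.
have e20 : 0 < complex.Re e / 2 by rewrite divr_gt0// -ltcR -eE.
move/cvgrPdist_lt/(_ _ e20): cr => cr; move/cvgrPdist_lt/(_ _ e20): ci => ci.
near=> n.
have -> (z : R[i]) :
    `|z| = `|(complex.Re z)%:C%C + 'i%C * (complex.Im z)%:C%C|.
  by rewrite -complexE.
rewrite (le_lt_trans (ler_normD _ _))// normrM.
have -> : `|'i%C| = 1 :> R[i] by rewrite complexiE normCi.
rewrite mul1r !normc_def/= !expr0n/= !addr0 !sqrtr_sqr.
rewrite -rmorphD/= eE ltcR [ltRHS]splitr ltrD//.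
  by near: n; move: cr; apply: filterS => n; rewrite raddfB.
by near: n; move: ci; apply: filterS => n; rewrite raddfB.
Unshelve. all: by end_near. Qed.

(** The order of a numeric field such as the complex numbers is only partial,
    so that the limit is compared with the bound through the identity
    expressing 0 <= z as z = |z|, which passes to limits. *)
Lemma cvg_le_numField (K : numFieldType) (T : Type) (F : set_system T)
    (f : T -> K^o) (l c : K) :
  ProperFilter F -> f @ F --> (l : K^o) -> (\forall x \near F, f x <= c) ->
  l <= c.
Proof.
move=> FF fl fc; rewrite -subr_ge0.
suff -> : c - l = `|c - l| by [].
have cf : (c - f x : K^o) @[x --> F] --> (c - l : K^o).
  by apply: cvgB => //; exact: cvg_cst.
apply: (cvg_unique (@norm_hausdorff K K^o) cf).
have := cvg_norm cf => h; apply: cvg_trans (h _); apply: near_eq_cvg.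
by apply: filterS fc => x; rewrite -subr_ge0 => /ger0_norm.
Qed.

Lemma cvg_conjC (R : realType) (T : Type) (F : set_system T)
    (f : T -> R[i]^o) (l : R[i]) :
  Filter F -> f @ F --> (l : R[i]^o) ->
  ((f x)^* : R[i]^o) @[x --> F] --> (l^* : R[i]^o).
Proof.
move=> FF /cvgrPdist_lt fl; apply/cvgrPdist_lt => e /fl; apply: filterS => x.
by rewrite -rmorphB/= norm_conjC.
Qed.

Lemma cvg_Re (R : realType) (T : Type) (F : set_system T)
    (f : T -> R[i]^o) (l : R[i]) :
  Filter F -> f @ F --> (l : R[i]^o) ->
  complex.Re (f x) @[x --> F] --> complex.Re l.
Proof.
move=> FF /cvgrPdist_lt fl; apply/cvgrPdist_lt => e e0.
have /fl : 0 < e%:C%C by rewrite ltcR.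
apply: filterS => x h; rewrite -ltcR; apply: le_lt_trans h.
by rewrite -raddfB normc_ge_Re.
Qed.

Lemma cvg_sum_nat (K : numFieldType) (T : Type) (F : set_system T)
    (f : nat -> T -> K^o) (l : nat -> K) n :
  Filter F -> (forall k, f k x @[x --> F] --> (l k : K^o)) ->
  (\sum_(0 <= k < n) f k x : K^o) @[x --> F] --> (\sum_(0 <= k < n) l k : K^o).
Proof.
move=> FF fl; elim: n => [|n IH].
  rewrite big_geq// (_ : (fun x => _) = fun=> 0); first exact: cvg_cst.
  by apply/funext => x; rewrite big_geq.
rewrite big_nat_recr//=
  (_ : (fun x => _) = fun x => \sum_(0 <= k < n) f k x + f n x).
  by apply: cvgD.
by apply/funext => x; rewrite big_nat_recr.
Qed.

(** * Squared norms in a Hilbert space *)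

Section SquaredNorm.
Variables (R : realType) (V : hilbertType R).
Implicit Types x y : V.

Definition sqnorm x : R := complex.Re (`|x| ^+ 2).

Lemma sqnormE x : (sqnorm x)%:C%C = `|x| ^+ 2.
Proof. by rewrite RRe_real// rpredX// normr_real. Qed.

Lemma sqnorm_ge0 x : 0 <= sqnorm x.
Proof. by rewrite -lecR sqnormE exprn_ge0. Qed.

Lemma hdot_CauchySchwarz x y : `|hdot V x y| <= `|x| * `|y|.
Proof.
rewrite -ler_sqr ?nnegrE ?mulr_ge0// exprMn -!hdotE.
exact: dot_CauchySchwarz.
Qed.

Lemma hdot_le_sqnorm x y : `|hdot V x y| <= (sqnorm x + sqnorm y)%:C%C.
Proof.
apply: le_trans (hdot_CauchySchwarz x y) _.
rewrite rmorphD/= !sqnormE -subr_ge0.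
have -> : `|x| ^+ 2 + `|y| ^+ 2 - `|x| * `|y| =
  (`|x| - `|y|) ^+ 2 + `|x| * `|y| by ring.
apply: addr_ge0; last by rewrite mulr_ge0.
by rewrite real_exprn_even_ge0// rpredB ?normr_real.
Qed.

Lemma sqnormD_le x y : sqnorm (x + y) <= (sqnorm x + sqnorm y) *+ 2.
Proof.
rewrite -lecR rmorphMn rmorphD/= !sqnormE.
have nxy : `|x + y| ^+ 2 <= (`|x| + `|y|) ^+ 2.
  by rewrite ler_sqr ?nnegrE ?addr_ge0// ler_normD.
apply: le_trans nxy _; rewrite -subr_ge0.
have -> : (`|x| ^+ 2 + `|y| ^+ 2) *+ 2 - (`|x| + `|y|) ^+ 2 =
  (`|x| - `|y|) ^+ 2 by ring.
by rewrite real_exprn_even_ge0// rpredB ?normr_real.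
Qed.

Lemma sqnormZ (a : R[i]) x : sqnorm (a *: x) = complex.Re (`|a| ^+ 2) * sqnorm x.
Proof.
apply: (@complexI R); rewrite rmorphM !sqnormE normrZ exprMn.
congr (_ * _); last by rewrite -sqnormE.
by rewrite [RHS]RRe_real ?rpredX ?normr_real.
Qed.

Lemma sqnorm0 : sqnorm 0 = 0.
Proof. by rewrite /sqnorm normr0 expr0n. Qed.

End SquaredNorm.

Lemma norm_eq_sqr (R : realType) (V W : hilbertType R) (x : V) (y : W) :
  `|x| ^+ 2 = `|y| ^+ 2 -> `|x| = `|y|.
Proof. by move=> h; apply/eqP; rewrite -(eqrXn2 (ltn0Sn 1)) ?nnegrE// h. Qed.

Lemma sqnorm_le (R : realType) (V W : hilbertType R) (x : V) (y : W) :
  `|x| <= `|y| -> sqnorm x <= sqnorm y.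
Proof. by move=> xy; rewrite -lecR !sqnormE ler_sqr ?nnegrE. Qed.

(** * The Hilbert direct sum of a sequence of Hilbert spaces *)

Section SequenceProduct.
Variables (R : realType) (G : nat -> hilbertType R).

Definition prodspace := forall n, G n.

HB.instance Definition _ := gen_eqMixin prodspace.
HB.instance Definition _ := gen_choiceMixin prodspace.

(* Each axiom holds coordinatewise. *)
Let addE (x y : prodspace) : prodspace := fun n => x n + y n.
Let oppE (x : prodspace) : prodspace := fun n => - x n.
Let zeroE : prodspace := fun n => 0.
Let addA : associative addE.
Proof. by move=> x y z; apply: functional_extensionality_dep => ?; exact: addrA. Qed.
Let addC : commutative addE.
Proof. by move=> x y; apply: functional_extensionality_dep => ?; exact: addrC. Qed.
Let add0 : left_id zeroE addE.
Proof. by move=> x; apply: functional_extensionality_dep => ?; exact: add0r. Qed.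
Let addN : left_inverse zeroE oppE addE.
Proof. by move=> x; apply: functional_extensionality_dep => ?; exact: addNr. Qed.

HB.instance Definition _ := GRing.isZmodule.Build prodspace addA addC add0 addN.

Let scaleE (a : R[i]) (x : prodspace) : prodspace := fun n => a *: x n.
Let scaleA a b v : scaleE a (scaleE b v) = scaleE (a * b) v.
Proof. by apply: functional_extensionality_dep => ?; exact: scalerA. Qed.
Let scale1 : left_id 1 scaleE.
Proof. by move=> x; apply: functional_extensionality_dep => ?; exact: scale1r. Qed.
Let scaleDr : right_distributive scaleE +%R.
Proof. by move=> a x y; apply: functional_extensionality_dep => ?; exact: scalerDr. Qed.
Let scaleDl v : {morph scaleE^~ v : a b / a + b}.
Proof. by move=> a b; apply: functional_extensionality_dep => ?; exact: scalerDl. Qed.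

HB.instance Definition _ :=
  GRing.Zmodule_isLmodule.Build R[i] prodspace scaleA scale1 scaleDr scaleDl.

Definition square_summable : {pred prodspace} :=
  [pred x : prodspace | `[< cvgn (series (fun n => sqnorm (x n))) >]].

Lemma square_summableP x :
  x \in square_summable <-> cvgn (series (fun n => sqnorm (x n))).
Proof. by rewrite inE. Qed.

Lemma square_summable_submod : submod_closed square_summable.
Proof.
split=> [|a x y].
  apply: (square_summableP _).2.
  rewrite (_ : series _ = fun=> 0); first exact: is_cvg_cst.
  by apply/funext => n; rewrite /series/= big1// => k _; rewrite sqnorm0.
move=> /(square_summableP _).1 cx /(square_summableP _).1 cy.
apply: (square_summableP _).2.
have cax := is_cvg_seriesZ (k := complex.Re (`|a| ^+ 2)) cx.
have c := is_cvg_seriesZ (k := 2) (is_cvg_seriesD cax cy).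
apply: (series_le_cvg _ _ _ c) => n.
- exact: sqnorm_ge0.
- apply: mulr_ge0 => //; apply: addr_ge0; last exact: sqnorm_ge0.
  by have := sqnorm_ge0 (a *: x n); rewrite sqnormZ.
- apply: le_trans (sqnormD_le (a *: x n) (y n)) _.
  by rewrite sqnormZ -[leLHS]mulr_natl.
Qed.

HB.instance Definition _ := GRing.isSubmodClosed.Build R[i] prodspace
  square_summable square_summable_submod.

Record dsum := Dsum { dcoord : prodspace; dcoordP : dcoord \in square_summable }.

HB.instance Definition _ := [isSub for dcoord].
HB.instance Definition _ := [Choice of dsum by <:].
HB.instance Definition _ := [SubChoice_isSubLmodule of dsum by <:].

End SequenceProduct.

Section DirectSumDot.
Variables (R : realType) (G : nat -> hilbertType R).
Implicit Types x y z : dsum G.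

Definition dterms x y : nat -> R[i] :=
  fun n => hdot (G n) (dcoord x n) (dcoord y n).

Definition ddot x y : R[i] := lim ((series (dterms x y) : nat -> R[i]^o) @ \oo).

Lemma dsum_cvg x : cvgn (series (fun n => sqnorm (dcoord x n))).
Proof. exact: (square_summableP _).1 (dcoordP x). Qed.

(** The terms are dominated by those of the two convergent series of squared
    norms, so the real and the imaginary parts converge absolutely. *)
Lemma ddot_cvg x y :
  (series (dterms x y) : nat -> R[i]^o) @ \oo --> (ddot x y : R[i]^o).
Proof.
have cxy := is_cvg_seriesD (@dsum_cvg x) (@dsum_cvg y).
have aux (f : R[i] -> R) : {morph f : u v / u + v} -> f 0 = 0 ->
    (forall (u : R[i]) r, `|u| <= r%:C%C -> `|f u| <= r) ->
    cvgn (fun n => f (series (dterms x y) n)).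
  move=> fD f0 fb.
  have -> : (fun n => f (series (dterms x y) n)) =
      series (fun n => f (dterms x y n)).
    by apply/funext => n; rewrite /series/= (big_morph f fD f0).
  apply: normed_cvg; apply: (series_le_cvg _ _ _ cxy) => n.
  - exact: normr_ge0.
  - by apply: addr_ge0; exact: sqnorm_ge0.
  - by apply: fb; exact: hdot_le_sqnorm.
apply: cvgP; apply: cvg_complex; apply: aux.
- by move=> [? ?] [? ?].
- by [].
- exact: Re_norm_le.
- by move=> [? ?] [? ?].
- by [].
- exact: Im_norm_le.
Qed.

Lemma ddot_unique x y (l : R[i]) :
  (series (dterms x y) : nat -> R[i]^o) @ \oo --> (l : R[i]^o) -> ddot x y = l.
Proof. exact: (cvg_unique (@norm_hausdorff _ _) (@ddot_cvg x y)). Qed.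

Lemma ddot_linear z : linear_for *%R (ddot^~ z).
Proof.
move=> a x y; apply: ddot_unique.
rewrite (_ : series _ =
    (fun n => a * series (dterms x z) n + series (dterms y z) n)).
  apply: cvgD; last exact: ddot_cvg.
  by apply: cvgMr; exact: ddot_cvg.
apply/funext => n; rewrite /series/= mulr_sumr -big_split/=.
by apply: eq_bigr => k _; rewrite /dterms linearPl.
Qed.

Lemma ddotC x y : ddot x y = (ddot y x)^*.
Proof.
apply: ddot_unique.
rewrite (_ : series _ = (fun n => (series (dterms y x) n)^*)).
  exact: cvg_conjC (@ddot_cvg y x).
apply/funext => n; rewrite /series/= rmorph_sum/=.
by apply: eq_bigr => k _; rewrite /dterms dotC.
Qed.

Lemma dterms_sum x n :
  series (dterms x x) n = \sum_(0 <= k < n) `|dcoord x k| ^+ 2.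
Proof. by apply: eq_bigr => k _; rewrite /dterms hdotE. Qed.

Lemma ddot_le x (c : R[i]) :
  (forall n, \sum_(0 <= k < n) `|dcoord x k| ^+ 2 <= c) -> ddot x x <= c.
Proof.
move=> h; apply: (@cvg_le_numField R[i] _ _ _ _ _ _ (@ddot_cvg x x)).
by apply: nearW => n; rewrite dterms_sum.
Qed.

Lemma ddot_partial_le x n : \sum_(0 <= k < n) `|dcoord x k| ^+ 2 <= ddot x x.
Proof.
rewrite -lerN2.
apply: (@cvg_le_numField R[i] _ _ _ _ _ _ (cvgN (@ddot_cvg x x))).
exists n => // m /= nm; rewrite lerN2 dterms_sum.
rewrite [leRHS](big_cat_nat (n := n))//= lerDl.
by apply: sumr_ge0 => k _; exact: exprn_ge0.
Qed.

Lemma dcoord_le x n : `|dcoord x n| ^+ 2 <= ddot x x.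
Proof.
apply: le_trans (ddot_partial_le x n.+1); rewrite big_nat_recr//= lerDr.
by apply: sumr_ge0 => k _; exact: exprn_ge0.
Qed.

Lemma dsumP x y : (forall n, dcoord x n = dcoord y n) -> x = y.
Proof. by move=> h; apply: val_inj; apply: functional_extensionality_dep. Qed.

Lemma ddot_gt0 x : x != 0 -> 0 < ddot x x.
Proof.
move=> x0; rewrite lt_def; apply/andP; split.
  apply: contra x0 => /eqP xx0; apply/eqP/dsumP => n.
  apply/eqP; rewrite -normr_eq0 -sqrf_eq0 eq_le exprn_ge0// andbT.
  by rewrite -xx0 dcoord_le.
exact: le_trans (exprn_ge0 2 (normr_ge0 _)) (dcoord_le x 0).
Qed.

Lemma ddot_linearr x : linear_for (@Num.conj R[i] \; *%R) (ddot x).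
Proof. by move=> a y z /=; rewrite ddotC ddot_linear rmorphD rmorphM/= -!ddotC. Qed.

HB.instance Definition _ := bilinear_isBilinear.Build R[i] (dsum G) (dsum G) R[i]
  *%R (@Num.conj R[i] \; *%R) ddot (ddot_linear, ddot_linearr).
HB.instance Definition _ := isHermitianSesquilinear.Build R[i] (dsum G) false
  (@Num.conj R[i]) ddot (fun x y => etrans (ddotC x y) (esym (mul1r _))).
HB.instance Definition _ := isDotProduct.Build R[i] (dsum G) ddot ddot_gt0.

End DirectSumDot.

Section DirectSumHilbert.
Variables (R : realType) (G : nat -> hilbertType R).

HB.instance Definition _ := Lmodule_isNormed.Build R[i] (dsum G)
  (dotnormD (@ddot R G)) (dotnormZ (@ddot R G)) (@dotnorm0_eq0 _ _ (@ddot R G)).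

Implicit Types x y : dsum G.

Lemma dsum_sqnorm x : `|x| ^+ 2 = ddot x x.
Proof. exact: sqr_dotnorm. Qed.

Lemma dsum_norm_le x (c : R[i]) : 0 <= c ->
  (forall n, \sum_(0 <= k < n) `|dcoord x k| ^+ 2 <= c ^+ 2) -> `|x| <= c.
Proof.
by move=> c0 h; rewrite -ler_sqr ?nnegrE// dsum_sqnorm; exact: ddot_le.
Qed.

Lemma dcoord_norm_le x n : `|dcoord x n| <= `|x|.
Proof. by rewrite -ler_sqr ?nnegrE// dsum_sqnorm dcoord_le. Qed.

Lemma bounded_square_summable (x : prodspace G) (M : R[i]) :
  (forall n, \sum_(0 <= k < n) `|x k| ^+ 2 <= M) ->
  x \in square_summable (G := G).
Proof.
move=> h; apply: (square_summableP _).2; apply: nondecreasing_is_cvgn.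
  apply: nondecreasing_series => n _ _; exact: sqnorm_ge0.
exists (complex.Re M) => _ [n _ <-].
have Mr : M = (complex.Re M)%:C%C.
  by rewrite RRe_real// ger0_real// (le_trans _ (h 0))// big_geq.
rewrite -lecR -Mr (le_trans _ (h n))// /series/= rmorph_sum/=.
by under eq_bigr do rewrite sqnormE.
Qed.

(** The coordinates of a Cauchy filter F converge, say to l.  If a ball of
    radius e centred at y belongs to F, then letting x tend to l along F in
    the inequality sum_(k < n) |x k - y k|^2 <= e^2, for a fixed n, puts the
    point l within e of y. *)
Lemma dsum_complete (F : set_system (dsum G)) :
  ProperFilter F -> cauchy F -> cvg F.
Proof.
move=> FF Fc.
have Fn n : cvg ((fun x : dsum G => dcoord x n) @ F).
  apply/cauchy_cvgP/cauchyP => e e0.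
  have [y Fy] := (cauchyP F).1 Fc e e0.
  exists (dcoord y n); apply: (@filterS _ F _ (ball y e)) Fy => x /=.
  rewrite -!ball_normE/= => h; apply: le_lt_trans h.
  exact: (dcoord_norm_le (y - x) n).
pose l : prodspace G := fun n => lim ((fun x : dsum G => dcoord x n) @ F).
have close e y : 0 < e -> F (ball y e) -> forall n,
    \sum_(0 <= k < n) `|l k - dcoord y k| ^+ 2 <= e ^+ 2.
  move=> e0 Fy n.
  have cv : ((fun x => \sum_(0 <= k < n) `|dcoord x k - dcoord y k| ^+ 2) :
      dsum G -> R[i]^o) @ F -->
      (\sum_(0 <= k < n) `|l k - dcoord y k| ^+ 2 : R[i]^o).
    apply: (@cvg_sum_nat R[i] _ F
      (fun k x => `|dcoord x k - dcoord y k| ^+ 2)) => k.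
    have ck : `|dcoord x k - dcoord y k| @[x --> F] -->
        (`|l k - dcoord y k| : R[i]^o).
      by apply: cvg_norm; apply: cvgB; [exact: Fn|exact: cvg_cst].
    by rewrite expr2; apply: cvgM.
  apply: (@cvg_le_numField R[i] _ _ _ _ _ _ cv).
  move: Fy; apply: filterS => x; rewrite -ball_normE/= => h.
  apply: (@le_trans _ _ (`|x - y| ^+ 2)).
    rewrite dsum_sqnorm; exact: (ddot_partial_le (x - y) n).
  by rewrite distrC ler_sqr ?nnegrE ?(ltW e0)// ltW.
have lP : l \in square_summable (G := G).
  have [y Fy] := (cauchyP F).1 Fc 1 ltr01.
  have := close 1 y ltr01 Fy.
  move/(@bounded_square_summable (l - dcoord y)) => h.
  by rewrite -(subrK (dcoord y) l) rpredD ?dcoordP.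
apply/cvg_ex; exists (Dsum lP).
apply/cvgrPdist_le => e e0.
have e20 : 0 < e / 2 by rewrite divr_gt0.
have [y Fy] := (cauchyP F).1 Fc _ e20.
move: (Fy); apply: filterS => x; rewrite -ball_normE/= => h.
rewrite -(subrK y (Dsum lP)) -addrA [e]splitr.
apply: le_trans (ler_normD _ _) _; apply: lerD; last exact: ltW.
apply: dsum_norm_le; first exact: ltW.
exact: close.
Qed.

HB.instance Definition _ := Uniform_isComplete.Build (dsum G) dsum_complete.

Definition hilbert_sum : hilbertType R :=
  @Hilbert R (dsum G : completeNormedModType R[i]) (@ddot R G)
    (fun x => esym (dsum_sqnorm x)).

End DirectSumHilbert.

(** * The real inner product *)

Section RealInnerProduct.
Variables (R : realType) (V : hilbertType R).
Implicit Types x y z : V.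

Lemma cvg_hdotl (T : Type) (F : set_system T) (f : T -> V) y z :
  Filter F -> f @ F --> y ->
  (hdot V (f x) z : R[i]^o) @[x --> F] --> (hdot V y z : R[i]^o).
Proof.
move=> FF /cvgrPdist_lt fy; apply/cvgrPdist_lt => e e0.
have z1 : 0 < `|z| + 1 by rewrite ltr_wpDl.
have /fy : 0 < e / (`|z| + 1) by rewrite divr_gt0.
apply: filterS => x; rewrite ltr_pdivlMr// => h; apply: le_lt_trans h.
rewrite -linearBl; apply: le_trans (hdot_CauchySchwarz _ _) _.
by rewrite ler_wpM2l// lerDl.
Qed.

Definition rdot x y : R := complex.Re (hdot V x y).

Lemma sqnorm_rdot x : sqnorm x = rdot x x.
Proof. by rewrite /sqnorm /rdot hdotE. Qed.

Lemma rdotC x y : rdot x y = rdot y x.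
Proof. by rewrite /rdot dotC; case: (hdot V y x). Qed.

Lemma rdotDl x y z : rdot (x + y) z = rdot x z + rdot y z.
Proof. by rewrite /rdot linearDl raddfD. Qed.

Lemma rdotZl (t : R) x y : rdot (t%:C%C *: x) y = t * rdot x y.
Proof. by rewrite /rdot dotZl Re_mulr. Qed.

Lemma rdotNl x y : rdot (- x) y = - rdot x y.
Proof. by rewrite /rdot linearNl raddfN. Qed.

Lemma rdotDr x y z : rdot x (y + z) = rdot x y + rdot x z.
Proof. by rewrite rdotC rdotDl !(rdotC x). Qed.

Lemma rdotNr x y : rdot x (- y) = - rdot x y.
Proof. by rewrite rdotC rdotNl rdotC. Qed.

Definition rdotE := (sqnorm_rdot, rdotDl, rdotDr, rdotNl, rdotNr).

Lemma sqnormD x y : sqnorm (x + y) = sqnorm x + sqnorm y + 2 * rdot x y.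
Proof. by rewrite !rdotE (rdotC y x); ring. Qed.

Lemma sqnormB x y : sqnorm (x - y) = sqnorm x + sqnorm y - 2 * rdot x y.
Proof. by rewrite !rdotE (rdotC y x); ring. Qed.

Lemma rdot_CauchySchwarz x y : rdot x y ^+ 2 <= sqnorm x * sqnorm y.
Proof.
rewrite -lecR rmorphXn rmorphM/= !sqnormE -exprMn.
apply: (@le_trans _ _ (`|hdot V x y| ^+ 2)).
  rewrite -add_Re2_Im2 -rmorphXn lecR lerDl; exact: sqr_ge0.
by rewrite ler_sqr ?nnegrE ?mulr_ge0// hdot_CauchySchwarz.
Qed.

End RealInnerProduct.

(** * The representation theorem *)

Section Riesz.
Variables (R : realType) (E : lmodType R[i]) (L : hilbertType R).
Variables (S : {linear E -> L}) (phi : E -> R[i]) (c : R[i]).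
Hypotheses (phi_lin : scalar phi) (c0 : 0 <= c)
  (phi_le : forall k, `|phi k| <= c * `|S k|).

Let phiD u v : phi (u + v) = phi u + phi v.
Proof. by have := phi_lin 1 u v; rewrite scale1r mul1r. Qed.

Let phi0 : phi 0 = 0.
Proof. by apply: (addrI (phi 0)); rewrite -phiD !addr0. Qed.

Let phiZ a u : phi (a *: u) = a * phi u.
Proof. by have := phi_lin a u 0; rewrite phi0 !addr0. Qed.

(* The representing vector is the limit of the S k along a minimizing
   sequence of this functional. *)
Let J k : R := sqnorm (S k) - 2 * complex.Re (phi k).

Let JE u (t : R) k : J (u + t%:C%C *: k) =
  J u + t ^+ 2 * sqnorm (S k) + 2 * t * (rdot (S u) (S k) - complex.Re (phi k)).
Proof.
rewrite /J linearD linearZ/= sqnormD phiD phiZ raddfD/= Re_mulr.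
rewrite [rdot (S u) _]rdotC rdotZl [rdot (S k) _]rdotC.
rewrite [sqnorm (_ *: _)]sqnorm_rdot rdotZl [rdot (S k) _]rdotC rdotZl.
by rewrite -sqnorm_rdot; ring.
Qed.

Let J_parallelogram u v :
  sqnorm (S u - S v) = 2 * J u + 2 * J v - 4 * J ((2^-1)%:C%C *: (u + v)).
Proof.
have -> : J ((2^-1)%:C%C *: (u + v)) =
    4^-1 * sqnorm (S u + S v) - complex.Re (phi u) - complex.Re (phi v).
  rewrite /J linearZ/= linearD phiZ phiD Re_mulr sqnorm_rdot rdotZl.
  by rewrite rdotC rdotZl -sqnorm_rdot raddfD/=; field.
by rewrite /J sqnormB sqnormD; field.
Qed.

Let J_lb k : - (complex.Re c) ^+ 2 <= J k.
Proof.
have cE : c = (complex.Re c)%:C%C by rewrite RRe_real// ger0_real.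
have sE : `|S k| = (complex.Re `|S k|)%:C%C by rewrite RRe_real// normr_real.
have h : complex.Re (phi k) <= complex.Re c * complex.Re `|S k|.
  rewrite -lecR rmorphM/= -cE -sE; apply: le_trans (phi_le k).
  by apply: le_trans (normc_ge_Re _); rewrite lecR ler_norm.
rewrite /J /sqnorm sE -rmorphXn/=.
have := sqr_ge0 (complex.Re c - complex.Re `|S k|); nra.
Qed.

Let J_has_inf : has_inf (range J).
Proof.
split; first by exists (J 0), 0.
by exists (- (complex.Re c) ^+ 2) => _ [k _ <-]; exact: J_lb.
Qed.

Let m := inf (range J).

Let m_le k : m <= J k.
Proof. by apply: ge_inf; [case: J_has_inf|exists k]. Qed.

Let minimizing n : exists k, J k < m + n.+1%:R^-1.
Proof.
have n0 : 0 < n.+1%:R^-1 :> R by rewrite invr_gt0.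
have [_ [k _ <-] h] := inf_adherent n0 J_has_inf.
by exists k.
Qed.

(** The Riesz theorem, for a functional phi that factors through S.  With the
    identity for S it gives adjoints, and in general it gives factorizations
    through S.  The second conclusion places y in the closure of the range of S,
    which determines y, so that it depends linearly on phi. *)
Lemma riesz_representation : exists y,
  [/\ forall k, phi k = hdot L (S k) y,
      forall z, (forall k, hdot L (S k) z = 0) -> hdot L y z = 0 & `|y| <= c].
Proof.
have [k_ kP] := choice minimizing.
(* By the parallelogram law, almost minimizing points have close images. *)
have : cvg ((S \o k_) @ \oo).
  apply/cauchy_cvgP/cauchyP => e e0.
  have eE : e = (complex.Re e)%:C%C by rewrite RRe_real// gtr0_real.
  have e20 : 0 < complex.Re e by rewrite -ltcR -eE.
  have [N NP] : exists N : nat, 4 * N.+1%:R^-1 < complex.Re e ^+ 2.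
    have e24 : 0 < complex.Re e ^+ 2 / 4 by rewrite divr_gt0// exprn_gt0.
    have := near_infty_natSinv_lt (PosNum e24).
    by move=> [N _ /(_ N (leqnn N))] /=; rewrite ltr_pdivlMr// mulrC; exists N.
  exists (S (k_ N)); exists N => // n /= Nn.
  rewrite -ball_normE/= -ltr_sqr ?nnegrE ?(ltW e0)// -sqnormE eE -rmorphXn/= ltcR.
  apply: le_lt_trans NP; rewrite J_parallelogram.
  have nN : n.+1%:R^-1 <= N.+1%:R^-1 :> R by rewrite lef_pV2 ?posrE// ler_nat.
  have := kP n; have := kP N; have := m_le ((2^-1)%:C%C *: (k_ N + k_ n)).
  move: (J _) (J _) (J _) nN; move: (n.+1%:R^-1) (N.+1%:R^-1) => a b p q r.
  lra.
move=> /cvg_ex[/= y ky].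
exists y.
(* The first variation at the minimum, in the direction k. *)
have Jlim k (t : R) :
    0 <= t ^+ 2 * sqnorm (S k) + 2 * t * (rdot y (S k) - complex.Re (phi k)).
  have h1 : (n.+1%:R^-1 + t ^+ 2 * sqnorm (S k) +
        2 * t * (rdot (S (k_ n)) (S k) - complex.Re (phi k))) @[n --> \oo] -->
      0 + t ^+ 2 * sqnorm (S k) + 2 * t * (rdot y (S k) - complex.Re (phi k)).
    apply: cvgD; first by apply: cvgD; [exact: cvg_harmonic|exact: cvg_cst].
    apply: cvgMr; apply: cvgB; last exact: cvg_cst.
    by apply: cvg_Re; apply: cvg_hdotl.
  rewrite add0r in h1.
  rewrite -(cvg_lim (@Rhausdorff R) h1).
  apply: (limr_ge (cvgP _ h1)); apply: nearW => n.
  have := kP n; have := m_le (k_ n + t%:C%C *: k); rewrite JE => h2 h3.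
  rewrite -(lerD2l m) addr0; apply: (le_trans h2).
  by rewrite !addrA !lerD2r ltW.
have ReE k : complex.Re (phi k) = rdot y (S k).
  (* the minimizer in t of the quadratic bound, up to the 1 that keeps the
     denominator nonzero *)
  have := Jlim k
    (- (rdot y (S k) - complex.Re (phi k)) / (sqnorm (S k) + 1)).
  have := sqnorm_ge0 (S k).
  move: (rdot y (S k)) (complex.Re (phi k)) (sqnorm (S k)) => a b s s0.
  have s1 : 0 < s + 1 by rewrite ltr_wpDl.
  have -> : (- (a - b) / (s + 1)) ^+ 2 * s +
      2 * (- (a - b) / (s + 1)) * (a - b) =
      - ((a - b) ^+ 2 * ((s + 2) / (s + 1) ^+ 2)) by field; rewrite gt_eqF.
  rewrite oppr_ge0 pmulr_lle0; last by rewrite divr_gt0 ?exprn_gt0 // ltr_wpDl.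
  by rewrite real_exprn_even_le0 ?num_real//= subr_eq0 => /eqP.
have phiE k : phi k = hdot L (S k) y.
  apply/eqP; rewrite eq_complex ReE rdotC eqxx/=; apply/eqP.
  have := ReE (- 'i%C *: k).
  rewrite phiZ linearZ rdotC /rdot dotZl.
  by rewrite !Re_mulNi.
split=> [//|z h|].
  have h1 : (hdot L (S (k_ n)) z : R[i]^o) @[n --> \oo] -->
      (hdot L y z : R[i]^o).
    exact: cvg_hdotl.
  apply: (cvg_unique (@norm_hausdorff R[i] R[i]^o) h1).
  rewrite (_ : (fun _ => _) = fun=> 0); first exact: cvg_cst.
  by apply/funext => n /=; rewrite h.
have h1 : `|hdot L (S (k_ n)) y| @[n --> \oo] -->
    (`|hdot L y y| : R[i]^o).
  by apply: cvg_norm; apply: cvg_hdotl.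
have h2 : (c * `|S (k_ n)| : R[i]^o) @[n --> \oo] --> (c * `|y| : R[i]^o).
  by apply: cvgMr; apply: cvg_norm.
have : `|hdot L y y| - c * `|y| <= 0.
  apply: (@cvg_le_numField R[i] _ _ _ _ _ _ (cvgB h1 h2)); apply: nearW => n.
  by rewrite subr_le0 -phiE.
rewrite subr_le0 hdotE normrX normr_id expr2.
have [->|y0] := eqVneq y 0; first by rewrite normr0.
by rewrite ler_pM2r// normr_gt0.
Qed.

End Riesz.

(** * Adjoints, factorizations and isometries *)

Section Operators.
Context {R : realType}.
Implicit Types H K L : hilbertType R.

Lemma hdot_extl H (u v : H) : (forall d, hdot H u d = hdot H v d) -> u = v.
Proof.
move=> h; apply/eqP; rewrite -subr_eq0 -normr_eq0 -sqrf_eq0 -hdotE.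
by rewrite linearBl/= h subrr.
Qed.

Lemma hdot_extr H (u v : H) : (forall d, hdot H d u = hdot H d v) -> u = v.
Proof. by move=> h; apply: hdot_extl => d; rewrite dotC h -dotC. Qed.

Lemma boundedOp_of H K (f : H -> K) (M : R[i]) :
  linear f -> 0 <= M -> (forall x, `|f x| <= M * `|x|) ->
  exists T : boundedOp H K, T =1 f.
Proof.
move=> lf M0 fM.
pose g : {linear H -> K} := HB.pack f (GRing.isLinear.Build _ _ _ _ f lf).
suff gb : bounded_near g (nbhs (0 : H)) by exists (BoundedOp gb).
apply/linear_boundedP; near=> r => x; apply: le_trans (fM x) _.
apply: ler_wpM2r => //; near: r; apply: nbhs_pinfty_ge; exact: ger0_real.
Unshelve. all: by end_near. Qed.

Lemma boundedOp_bound H K (T : boundedOp H K) :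
  exists2 M : R[i], 0 <= M & forall x, `|T x| <= M * `|x|.
Proof.
have /linear_boundedP/pinfty_ex_gt0 [M M0 h] := bopP T.
by exists M => //; exact: ltW.
Qed.

Lemma boundedOp_comp H K L (S : boundedOp K L) (T : boundedOp H K) :
  exists U : boundedOp H L, forall x, U x = S (T x).
Proof.
have [M M0 SM] := boundedOp_bound S; have [N N0 TN] := boundedOp_bound T.
apply: (@boundedOp_of _ _ (S \o T) (M * N)).
- by move=> a x y /=; rewrite !linearP.
- exact: mulr_ge0.
- move=> x /=; apply: le_trans (SM _) _; rewrite -mulrA.
  exact: ler_wpM2l.
Qed.

Lemma adjoint_exists H K (T : boundedOp H K) : exists Ts, is_adjoint T Ts.
Proof.
have [M M0 TM] := boundedOp_bound T.
have h y : exists z,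
    (forall x, hdot K (T x) y = hdot H x z) /\ `|z| <= M * `|y|.
  have [||x|z [zE _ zM]] := @riesz_representation R H H idfun
    (fun x => hdot K (T x) y) (M * `|y|).
  - by move=> a u v; rewrite linearP dotPl.
  - exact: mulr_ge0.
  - apply: le_trans (hdot_CauchySchwarz _ _) _.
    by rewrite mulrAC; apply: ler_wpM2r.
  - by exists z.
have [ts tsP] := choice h.
have [||y|Ts TsE] := @boundedOp_of _ _ ts M.
- move=> a u v; apply: hdot_extr => d.
  by rewrite linearP/= -!(tsP _).1 linearP.
- by [].
- exact: (tsP y).2.
by exists Ts => x y; rewrite TsE; exact: (tsP y).1.
Qed.

Lemma is_adjoint_sym H K (T : boundedOp H K) Ts :
  is_adjoint T Ts -> is_adjoint Ts T.
Proof. by move=> h x y; rewrite dotC -h -dotC. Qed.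

Lemma adjoint_contraction H K (T : boundedOp H K) Ts : is_adjoint T Ts ->
  (forall x, `|T x| <= `|x|) -> forall y, `|Ts y| <= `|y|.
Proof.
move=> h T1 y; have [->|y0] := eqVneq (Ts y) 0; first by rewrite normr0.
have y1 : 0 < `|Ts y| by rewrite normr_gt0.
rewrite -(ler_pM2l y1) -expr2 -hdotE -h.
apply: le_trans (real_ler_norm _) _.
  by rewrite h hdotE rpredX// normr_real.
apply: le_trans (hdot_CauchySchwarz _ _) _.
by apply: ler_wpM2r.
Qed.

(** Douglas' factorization lemma.  The adjoint of Gam is built first: it sends
    d to the vector of the closure of the range of S representing the
    functional k |-> <F k, d>. *)
Lemma factorization E L D (S : boundedOp E L) (F : boundedOp E D) :
  (forall k, `|F k| <= `|S k|) ->
  exists2 Gam : boundedOp L D,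
    forall k, Gam (S k) = F k & forall x, `|Gam x| <= `|x|.
Proof.
move=> FS.
have h d : exists z, [/\ forall k, hdot D (F k) d = hdot L (S k) z,
    forall w, (forall k, hdot L (S k) w = 0) -> hdot L z w = 0 & `|z| <= `|d|].
  apply: (@riesz_representation R E L S (fun k => hdot D (F k) d) `|d|) => //.
  - by move=> a u v; rewrite linearP dotPl.
  - move=> k; apply: le_trans (hdot_CauchySchwarz _ _) _.
    by rewrite mulrC; apply: ler_wpM2l.
have [gs gsP] := choice h.
have [||d|Gs GsE] := @boundedOp_of _ _ gs 1.
- move=> a u v; apply/eqP; rewrite -subr_eq0 -normr_eq0 -sqrf_eq0 -hdotE.
  set w := _ - _.
  have w0 k : hdot L (S k) w = 0.
    case: (gsP (a *: u + v)) (gsP u) (gsP v) => [h1 _ _] [h2 _ _] [h3 _ _].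
    by rewrite linearBr/= linearP/= -h1 -h2 -h3 linearP/= subrr.
  have gs0 d : hdot L (gs d) w = 0 by case: (gsP d) => _ + _; apply.
  by rewrite {1}/w linearBl/= dotPl !gs0 mulr0 addr0 subrr.
- by [].
- by rewrite mul1r; case: (gsP d).
have [Gam GamP] := adjoint_exists Gs.
exists Gam.
  move=> k; apply: hdot_extl => d.
  by rewrite (is_adjoint_sym GamP) GsE; case: (gsP d) => ->.
apply: (adjoint_contraction GamP) => d.
by rewrite GsE; case: (gsP d).
Qed.

(** Polarization recovers the real part of the inner product from the norm; the
    imaginary part is the real part after multiplication by - 'i. *)
Lemma norm_isometry H K (f : {linear H -> K}) :
  (forall x, `|f x| = `|x|) -> isometry (hdot K) (hdot H) f.
Proof.
move=> h.
have sqf x : sqnorm (f x) = sqnorm x by rewrite /sqnorm h.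
have rf x y : rdot (f x) (f y) = rdot x y.
  have := sqf (x + y); rewrite linearD/= !sqnormD !sqf => /addrI.
  by apply: mulfI.
move=> x y; apply/eqP; rewrite eq_complex; apply/andP; split; first exact/eqP/rf.
have := rf (- 'i%C *: x) y.
by rewrite linearZ /rdot !dotZl !Re_mulNi => ->.
Qed.

Lemma contractive_norm H K (T : boundedOp H K) :
  contractive T -> forall x, `|T x| <= `|x|.
Proof.
move=> cT x; have [->|x0] := eqVneq x 0; first by rewrite linear0 !normr0.
have x1 : 0 < `|x| by rewrite normr_gt0.
have u1 : `| `|x|^-1 *: x | = 1 by exact: normfZV.
have : ((complex.Re `|T (`|x|^-1 *: x)%R|)%:E <= 1%:E)%E.
  apply: le_trans cT; apply: ereal_sup_ubound; exists (`|x|^-1 *: x) => //=.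
  by rewrite u1.
rewrite lee_fin -lecR RRe_real ?normr_real// linearZ/= normrZ normfV normr_id.
by rewrite ler_pdivrMl// mulr1.
Qed.

End Operators.

(** * Operators into a direct sum *)

Section SumOperators.
Context {R : realType}.
Implicit Types H E K : hilbertType R.

Lemma sum_operator H (G : nat -> hilbertType R) (f : forall n, H -> G n)
    (M : R[i]) :
  (forall n, linear (f n)) -> 0 <= M ->
  (forall h n, \sum_(0 <= k < n) `|f k h| ^+ 2 <= (M * `|h|) ^+ 2) ->
  exists D : boundedOp H (hilbert_sum G), forall h n, dcoord (D h) n = f n h.
Proof.
move=> fl M0 fM.
have fP h : ((fun n => f n h) : prodspace G) \in square_summable (G := G).
  exact: bounded_square_summable (fM h).
pose d h : hilbert_sum G := Dsum (fP h).
have [||x|D DE] := @boundedOp_of R H (hilbert_sum G) d M.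
- by move=> a u v; apply: dsumP => n; exact: fl.
- exact: M0.
- by apply: dsum_norm_le; [exact: mulr_ge0|exact: fM].
by exists D => h n; rewrite DE.
Qed.

Lemma dsum_sqnormE (G : nat -> hilbertType R) (x : hilbert_sum G) (c : R[i]) N :
  (forall n, (N <= n)%N -> \sum_(0 <= k < n) `|dcoord x k| ^+ 2 = c) ->
  `|x| ^+ 2 = c.
Proof.
move=> h; rewrite dsum_sqnorm; apply: ddot_unique.
apply: (@cvg_trans _ ((fun=> c : R[i]^o) @ \oo)); last exact: cvg_cst.
apply: near_eq_cvg.
by exists N => // n /= /h <-; rewrite dterms_sum.
Qed.

(** The direct sum of the family H, E, E, ... is the space of an isometric
    dilation, and it also serves as a space containing the sum of H and E. *)
Definition hcons H E : nat -> hilbertType R := fun n => if n is 0 then H else E.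

Definition hconsf (T : Type) H E (a : T -> H) (b : nat -> T -> E) n :
    T -> hcons H E n :=
  if n is n'.+1 return T -> hcons H E n then b n' else a.

Lemma hconsf_sum (T : Type) H E (a : T -> H) (b : nat -> T -> E) n t :
  \sum_(0 <= j < n.+1) `|hconsf a b j t| ^+ 2 =
  `|a t| ^+ 2 + \sum_(0 <= j < n) `|b j t| ^+ 2.
Proof. by rewrite big_nat_recl. Qed.

Lemma hconsf_operator H E K (a : K -> H) (b : nat -> K -> E) (M : R[i]) :
  linear a -> (forall n, linear (b n)) -> 0 <= M ->
  (forall k n,
    `|a k| ^+ 2 + \sum_(0 <= j < n) `|b j k| ^+ 2 <= (M * `|k|) ^+ 2) ->
  exists D : boundedOp K (hilbert_sum (hcons H E)),
    forall k n, dcoord (D k) n = hconsf a b n k.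
Proof.
move=> al bl M0 h; apply: (@sum_operator _ _ (hconsf a b) M) => //.
  by case.
move=> k n; apply: le_trans (h k n).
by rewrite -hconsf_sum big_nat_recr//= lerDl exprn_ge0.
Qed.

(** Two operators with values in different spaces are joined into one,
    k |-> (A k, D k, 0, 0, ...), an isometry if D is a defect operator of A. *)
Lemma column_operator H E K (A : boundedOp K H) (D : boundedOp K E) :
  exists2 C : boundedOp K (hilbert_sum (hcons H E)),
    forall k n,
      dcoord (C k) n = hconsf A (fun j k => if j is 0 then D k else 0) n k &
    forall k, `|C k| ^+ 2 = `|A k| ^+ 2 + `|D k| ^+ 2.
Proof.
have [MA MA0 AM] := boundedOp_bound A; have [MD MD0 DM] := boundedOp_bound D.
pose b j k : E := if j is 0 then D k else 0.
have sumE n k : \sum_(0 <= j < n.+1) `|b j k| ^+ 2 = `|D k| ^+ 2.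
  rewrite big_nat_recl//= big1 ?addr0// => j _.
  by rewrite normr0 expr0n.
have [|||k n|C CE] := @hconsf_operator H E K A b (MA + MD).
- exact: linearP.
- by case=> [|n] a u v; [exact: linearP|rewrite /b scaler0 addr0].
- exact: addr_ge0.
- apply: (@le_trans _ _ (`|A k| ^+ 2 + `|D k| ^+ 2)).
    by rewrite lerD2l -(sumE n k) big_nat_recr//= lerDl exprn_ge0.
  apply: (@le_trans _ _ ((MA * `|k|) ^+ 2 + (MD * `|k|) ^+ 2)).
    by apply: lerD; rewrite ler_sqr ?nnegrE ?mulr_ge0.
  rewrite -subr_ge0.
  have -> : ((MA + MD) * `|k|) ^+ 2 -
      ((MA * `|k|) ^+ 2 + (MD * `|k|) ^+ 2) = (MA * MD * `|k| ^+ 2) *+ 2 by ring.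
  by rewrite mulrn_wge0// !mulr_ge0// exprn_ge0.
exists C => // k; apply: (dsum_sqnormE (N := 2)) => -[|[|n]]// _.
under eq_bigr do rewrite CE.
by rewrite hconsf_sum sumE.
Qed.

Lemma first_coordinate H E : exists2 P : boundedOp (hilbert_sum (hcons H E)) H,
  forall x, P x = dcoord x 0%N & forall x, `|P x| <= `|x|.
Proof.
have [| |x|P PE] := @boundedOp_of R (hilbert_sum (hcons H E)) H
  (fun x => dcoord x 0%N) 1.
- by [].
- by [].
- by rewrite mul1r; exact: (dcoord_norm_le x 0).
by exists P => // x; rewrite PE; exact: (dcoord_norm_le x 0).
Qed.

(** The map (x0, x1, x2, ...) |-> (A x0, D x0, x1, x2, ...), where the shift of
    the later coordinates makes room for what A lacks to being isometric. *)
Lemma shift_isometry H E (A : boundedOp H H) (D : boundedOp H E) :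
  (forall h, `|A h| ^+ 2 + `|D h| ^+ 2 = `|h| ^+ 2) ->
  exists2 V : boundedOp (hilbert_sum (hcons H E)) (hilbert_sum (hcons H E)),
    forall x n, dcoord (V x) n =
      hconsf (fun x : hilbert_sum (hcons H E) => A (dcoord x 0%N))
        (fun j x => if j is j'.+1 then dcoord x j'.+1 else D (dcoord x 0%N)) n x &
    forall x, `|V x| = `|x|.
Proof.
move=> AD; set M := hilbert_sum (hcons H E).
pose a (x : M) : H := A (dcoord x 0%N).
pose b j (x : M) : E := if j is j'.+1 then dcoord x j'.+1 else D (dcoord x 0%N).
have sumE n x : `|a x| ^+ 2 + \sum_(0 <= j < n.+1) `|b j x| ^+ 2 =
    \sum_(0 <= j < n.+1) `|dcoord x j| ^+ 2.
  by rewrite big_nat_recl//= addrA AD [RHS]big_nat_recl.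
have [|||x n|V VE] := @hconsf_operator H E M a b 1.
- by move=> c u v; exact: linearP.
- by case=> [|n] c u v; [exact: linearP|].
- by [].
- rewrite mul1r dsum_sqnorm.
  apply: le_trans (ddot_partial_le x n.+1).
  by rewrite -sumE lerD2l big_nat_recr//= lerDl exprn_ge0.
exists V => // x.
apply: norm_eq_sqr.
have VsumE n : \sum_(0 <= j < n.+2) `|dcoord (V x) j| ^+ 2 =
    \sum_(0 <= j < n.+1) `|dcoord x j| ^+ 2.
  by under eq_bigr do rewrite VE; rewrite hconsf_sum sumE.
rewrite 2!dsum_sqnorm; apply/le_anti/andP; split; apply: ddot_le => n.
  apply: le_trans (ddot_partial_le x n.+1); rewrite -VsumE.
  by rewrite 2?big_nat_recr//= -addrA lerDl addr_ge0// exprn_ge0.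
apply: le_trans (ddot_partial_le (V x) n.+2); rewrite VsumE.
by rewrite big_nat_recr//= lerDl exprn_ge0.
Qed.

Lemma ddot_first (G : nat -> hilbertType R) (x y : dsum G) :
  (forall n, dcoord x n.+1 = 0) ->
  ddot x y = hdot (G 0%N) (dcoord x 0%N) (dcoord y 0%N).
Proof.
move=> x0; apply: ddot_unique.
apply: (@cvg_trans _
  ((fun=> hdot (G 0%N) (dcoord x 0%N) (dcoord y 0%N) : R[i]^o) @ \oo)).
  apply: near_eq_cvg; exists 1%N => // -[//|n] _.
  rewrite /series/= big_nat_recl// big1 ?addr0// => k _.
  by rewrite /dterms x0 linear0l.
exact: cvg_cst.
Qed.

Lemma zero_operator H K : exists Z : boundedOp H K, forall h, Z h = 0.
Proof.
apply: (@boundedOp_of _ _ _ (fun=> 0) 0) => //.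
- by move=> a u v; rewrite scaler0 addr0.
- by move=> x; rewrite normr0 mul0r.
Qed.

Lemma id_operator H : exists I : boundedOp H H, forall h, I h = h.
Proof. by apply: (@boundedOp_of _ _ _ id 1) => // x; rewrite mul1r. Qed.

Lemma first_summand H E :
  exists2 J : boundedOp H (hilbert_sum (hcons H E)),
  forall h, dcoord (J h) 0%N = h /\ (forall n, dcoord (J h) n.+1 = 0) &
  forall h, `|J h| = `|h|.
Proof.
have [I IE] := id_operator H; have [Z ZE] := zero_operator H E.
have [J JE Jn] := column_operator I Z.
exists J => h.
  split; first by rewrite JE /= IE.
  by case=> [|n]; rewrite JE/= ?ZE.
by apply: norm_eq_sqr; rewrite Jn IE ZE normr0 expr0n addr0.
Qed.

Lemma first_summand_adjoint H E (J : boundedOp H (hilbert_sum (hcons H E)))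
    (P : boundedOp (hilbert_sum (hcons H E)) H) :
  (forall h, dcoord (J h) 0%N = h /\ (forall n, dcoord (J h) n.+1 = 0)) ->
  (forall x, P x = dcoord x 0%N) -> is_adjoint J P.
Proof.
move=> Jc Pc h x; rewrite Pc.
by have := @ddot_first (hcons H E) (J h) x (Jc h).2; rewrite (Jc h).1.
Qed.

End SumOperators.

(** * Defect operators *)

Section Defect.
Context {R : realType}.
Implicit Types H K : hilbertType R.

(** The operator inequalities 0 <= q <= 1, the second one in the equivalent form
    q^2 <= q, by which |q h|^2 is controlled. *)
Record positive_contraction H (q : H -> H) := PositiveContraction {
  pc_linear : linear q;
  pc_sym : forall h k, rdot (q h) k = rdot h (q k);
  pc_ge0 : forall h, 0 <= rdot (q h) h;
  pc_sq : forall h, sqnorm (q h) <= rdot (q h) h }.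

(** If 0 <= q <= 1, then q - q^2 = q (1 - q) is again between 0 and 1. *)
Lemma positive_contraction_step H (q : H -> H) :
  positive_contraction q -> positive_contraction (fun h => q h - q (q h)).
Proof.
move=> [ql qs q0 q1]; split.
- by move=> a u v /=; rewrite !ql scalerBr opprD addrACA.
- by move=> h k; rewrite !rdotE !qs.
- by move=> h; rewrite rdotDl rdotNl (qs (q h)) -sqnorm_rdot subr_ge0.
- move=> h.
  have qB u v : q (u - v) = q u - q v.
    by rewrite addrC -scaleN1r ql scaleN1r addrC.
  (* (q - q^2) - (q - q^2)^2 is (1 - q) q (1 - q) + q (q - q^2) q *)
  have := q1 (q h); have := q0 (h - q h); rewrite qB !rdotE.
  rewrite (qs (q h) h) (rdotC (q h) (q (q h))).
  move: (rdot _ _) (rdot _ _) (rdot _ _) => a b c; lra.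
Qed.

Lemma positive_contraction_complement H K (T : boundedOp H K)
    (Ts : boundedOp K H) :
  is_adjoint T Ts -> (forall h, `|T h| <= `|h|) ->
  positive_contraction (fun h => h - Ts (T h)).
Proof.
move=> adT T1.
have r h k : rdot (Ts (T h)) k = rdot (T h) (T k).
  by rewrite /rdot (is_adjoint_sym adT).
split.
- by move=> a u v /=; rewrite (linearP T) (linearP Ts) scalerBr opprD addrACA.
- by move=> h k; rewrite !rdotE r (rdotC h (Ts _)) r (rdotC (T k)).
- by move=> h; rewrite rdotDl rdotNl r -!sqnorm_rdot subr_ge0 sqnorm_le.
- move=> h.
  have := sqnorm_le (adjoint_contraction adT T1 (T h)).
  rewrite !rdotE (rdotC h (Ts _)) !r; lra.
Qed.

(** An operator D with D^* D = 1 - T^* T, obtained without square roots.  Put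
    q 0 = 1 - T^* T and q n.+1 = q n - (q n)^2.  The squares telescope,

      sum_(k < n) |q k h|^2 = <q 0 h, h> - <q n h, h>,

    and the remainder tends to 0: the |q k h| decrease and their squares have
    bounded sums, so that |q n h|^2 = O(1/n).  Hence D h = (q n h)_n is a
    square-summable sequence whose squared norm is <q 0 h, h>. *)
Lemma defect_operator H K (T : boundedOp H K) : (forall h, `|T h| <= `|h|) ->
  exists (E : hilbertType R) (D : boundedOp H E),
    forall h, `|T h| ^+ 2 + `|D h| ^+ 2 = `|h| ^+ 2.
Proof.
move=> T1; have [Ts adT] := adjoint_exists T.
pose step (q : H -> H) h := q h - q (q h).
pose q n := iter n step (fun h => h - Ts (T h)).
have qP n : positive_contraction (q n).
  elim: n => [|n IH]; first exact: positive_contraction_complement.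
  exact: positive_contraction_step.
have qS n h : rdot (q n.+1 h) h = rdot (q n h) h - sqnorm (q n h).
  by rewrite /q iterS -/(q n) /step rdotDl rdotNl (pc_sym (qP n) (q n h)) -sqnorm_rdot.
have tele n h : \sum_(0 <= k < n) sqnorm (q k h) = rdot (q 0 h) h - rdot (q n h) h.
  elim: n => [|n IH]; first by rewrite big_geq// subrr.
  by rewrite big_nat_recr//= IH qS; ring.
have q0E h : rdot (q 0 h) h = sqnorm h - sqnorm (T h).
  by rewrite /q/= rdotDl rdotNl [rdot (Ts _) h]/rdot (is_adjoint_sym adT) !sqnorm_rdot.
have decr n h : sqnorm (q n.+1 h) <= sqnorm (q n h).
  rewrite /q iterS -/(q n) /step; have := pc_sq (qP n) (q n h).
  have := pc_ge0 (qP n) (q n h); rewrite !rdotE (rdotC (q n h) (q n (q n h))).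
  move: (rdot _ _) (rdot _ _) (rdot _ _) => a b c; lra.
have nsq n h : n%:R * sqnorm (q n h) <= rdot (q 0 h) h.
  apply: (@le_trans _ _ (\sum_(0 <= k < n) sqnorm (q k h))); last first.
    by rewrite tele gerBl (pc_ge0 (qP n)).
  rewrite mulr_natl -[X in _ *+ X]subn0 -sumr_const_nat.
  apply: ler_sum_nat => k /andP[_ kn].
  elim: n kn => // n IH; rewrite ltnS leq_eqVlt => /orP[/eqP ->|kn]; first exact: decr.
  exact: le_trans (decr n h) (IH kn).
have sumC n h : \sum_(0 <= k < n) `|q k h| ^+ 2 =
    (rdot (q 0 h) h - rdot (q n h) h)%:C%C.
  by rewrite -tele rmorph_sum/=; apply: eq_bigr => k _; rewrite sqnormE.
have [| |h n|D DE] := @sum_operator R H (fun=> H) q 1.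
- by move=> n; exact: pc_linear (qP n).
- by [].
- rewrite mul1r sumC -sqnormE lecR q0E.
  by have := pc_ge0 (qP n) h; have := sqnorm_ge0 (T h); lra.
exists (hilbert_sum (fun=> H)), D => h.
have -> : `|h| ^+ 2 = `|T h| ^+ 2 + (rdot (q 0 h) h)%:C%C.
  by rewrite -!sqnormE -rmorphD/= q0E addrC subrK.
congr (_ + _); rewrite dsum_sqnorm; apply/le_anti/andP; split.
  apply: ddot_le => n; under eq_bigr do rewrite DE.
  by rewrite sumC lecR gerBl (pc_ge0 (qP n)).
have dE : ddot (D h) (D h) = (complex.Re (ddot (D h) (D h)))%:C%C.
  by rewrite RRe_real// -dsum_sqnorm rpredX// normr_real.
have part n : rdot (q 0 h) h - rdot (q n h) h <= complex.Re (ddot (D h) (D h)).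
  rewrite -lecR -dE -sumC; apply: le_trans (ddot_partial_le (D h) n).
  by under [leRHS]eq_bigr do rewrite DE.
rewrite dE lecR leNgt; apply/negP => lt.
set d := complex.Re _ in part lt; set a := rdot (q 0 h) h in part lt nsq.
have r0 : 0 < a - d by rewrite subr_gt0.
(* Any gap a - d > 0 would bound all the remainders from below. *)
have tn n : (a - d) ^+ 2 * n%:R <= a * sqnorm h.
  have t1 : a - d <= rdot (q n h) h by have := part n; lra.
  apply: (@le_trans _ _ (rdot (q n h) h ^+ 2 * n%:R)).
    by apply: ler_wpM2r => //; rewrite ler_sqr ?nnegrE ?(pc_ge0 (qP n))// ltW.
  apply: (@le_trans _ _ (sqnorm (q n h) * sqnorm h * n%:R)).
    by apply: ler_wpM2r => //; exact: rdot_CauchySchwarz.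
  by rewrite mulrAC; apply: ler_wpM2r; [exact: sqnorm_ge0|rewrite mulrC nsq].
have B0 : 0 <= a * sqnorm h / (a - d) ^+ 2.
  by rewrite divr_ge0 ?exprn_ge0 ?(ltW r0)// mulr_ge0 ?sqnorm_ge0// (pc_ge0 (qP 0)).
have := archi_boundP B0; rewrite ltNge => /negP; apply.
by rewrite ler_pdivlMr ?exprn_gt0// mulrC tn.
Qed.

End Defect.

(** * Isometric dilations of intertwined contractions *)

Section Dilation.
Context {R : realType}.
Implicit Types H K E : hilbertType R.

(** V (x0, x1, ...) = (T x0, D x0, x1, ...) with D a defect operator of T.  The
    last clause, by which V agrees with T where T is isometric already, holds
    because D vanishes there. *)
Lemma isometric_dilation H (T : boundedOp H H) : (forall h, `|T h| <= `|h|) ->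
  exists K (J : boundedOp H K) (P : boundedOp K H) (V : boundedOp K K),
  [/\ forall h, `|J h| = `|h|, is_adjoint J P, forall x, `|V x| = `|x|,
      forall x, P (V x) = T (P x) &
      forall h, `|T h| = `|h| -> V (J h) = J (T h)].
Proof.
move=> T1; have [E [D TD]] := defect_operator T1.
have [J Jc Jn] := first_summand H E.
have [P Pc _] := first_coordinate H E.
have [V Vc Vn] := shift_isometry TD.
exists (hilbert_sum (hcons H E)), J, P, V; split=> //.
- exact: first_summand_adjoint.
- by move=> x; rewrite !Pc Vc.
move=> h Th; have D0 : D h = 0.
  apply/eqP; rewrite -normr_eq0 -sqrf_eq0.
  by rewrite -(inj_eq (addrI (`|T h| ^+ 2))) TD Th addr0.
apply: dsumP => -[|[|n]]; rewrite Vc /=.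
- by rewrite !(Jc _).1.
- by rewrite (Jc _).1 D0 (Jc _).2.
- by rewrite !(Jc _).2.
Qed.

Lemma isometry_adjointK H K (J : boundedOp H K) P :
  (forall h, `|J h| = `|h|) -> is_adjoint J P -> forall h, P (J h) = h.
Proof.
move=> Jn adJ h; apply: hdot_extl => d.
by rewrite (is_adjoint_sym adJ); exact: norm_isometry.
Qed.

(** The range of J is closed, being the kernel of 1 - J P with P the adjoint. *)
Lemma hilbertSub_of_isometry H K (J : boundedOp H K) :
  (forall h, `|J h| = `|h|) -> exists Js : hilbertSub H K, forall h, Js h = J h.
Proof.
move=> Jn; have [P adP] := adjoint_exists J.
have PJ := isometry_adjointK Jn adP.
suff clJ : closed (range J).
  by exists (@HilbertSub R H K J (norm_isometry Jn) clJ).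
have -> : range J = (fun x => x - J (P x)) @^-1` [set 0].
  apply/seteqP; split=> [_ [h _ <-]|x /= /eqP].
    by rewrite /= PJ subrr.
  by rewrite subr_eq0 => /eqP ->; exists (P x).
apply: closed_comp; last first.
  exact: accessible_closed_set1 (hausdorff_accessible (@norm_hausdorff _ _)) _.
move=> x _; apply: cvgB; first exact: cvg_id.
apply: (@continuous_comp _ _ _ P J).
  exact: bounded_linear_continuous (bopP P) x.
exact: bounded_linear_continuous (bopP J) _.
Qed.

Lemma coisometric_adjoint H K (V : boundedOp H K) (Z : boundedOp K H) :
  (forall x, `|V x| = `|x|) -> is_adjoint V Z -> coisometric Z.
Proof.
by move=> Vn adV; exists V; [exact: is_adjoint_sym|exact: norm_isometry].
Qed.

(** Taking adjoints turns a lifting of A, compressed by the projections P1 and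
    P2, into an extension of its adjoint T. *)
Lemma adjoint_extension H K1 K2 (J1 : boundedOp H K1) (J2 : boundedOp H K2) P1 P2
    (A T : boundedOp H H) (W : boundedOp K1 K2) (S : boundedOp K2 K1) :
  is_adjoint J1 P1 -> is_adjoint J2 P2 -> is_adjoint T A -> is_adjoint W S ->
  (forall x, P2 (W x) = A (P1 x)) -> forall h, S (J2 h) = J1 (T h).
Proof.
move=> ad1 ad2 adT adW PW h; apply: hdot_extr => x.
rewrite -adW -(is_adjoint_sym ad1 x) -(is_adjoint_sym adT) -PW.
by rewrite (is_adjoint_sym ad2).
Qed.

Lemma is_adjoint_comp H K L (S : boundedOp K L) Ss (T : boundedOp H K) Ts
    (U : boundedOp H L) (Us : boundedOp L H) :
  is_adjoint S Ss -> is_adjoint T Ts -> (forall x, U x = S (T x)) ->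
  (forall y, Us y = Ts (Ss y)) -> is_adjoint U Us.
Proof. by move=> adS adT UE UsE x y; rewrite UE UsE adS adT. Qed.

(** A1 is dilated to V1, and B' = B P1, which intertwines V1 with A2, is
    completed by its defect operator D to an isometry W0 = (B', D) into M.  On the
    range of W0 the required second isometry is determined, as it must send
    W0 k to W0 (V1 k).  A contraction T on M that does this and has first
    component A2 P0 is obtained from the factorization lemma, and its isometric
    dilation still agrees with T on the range of W0, where T is isometric. *)
Lemma isometric_intertwining H (A1 A2 B : boundedOp H H) :
  (forall h, `|A1 h| <= `|h|) -> (forall h, `|A2 h| <= `|h|) ->
  (forall h, `|B h| <= `|h|) ->
  (forall h, B (A1 h) = A2 (B h)) ->
  exists K1 K2 (J1 : boundedOp H K1) (P1 : boundedOp K1 H)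
    (J2 : boundedOp H K2) (P2 : boundedOp K2 H)
    (V1 : boundedOp K1 K1) (V2 : boundedOp K2 K2) (W : boundedOp K1 K2),
  [/\ (forall h, `|J1 h| = `|h|) /\ is_adjoint J1 P1,
      (forall h, `|J2 h| = `|h|) /\ is_adjoint J2 P2,
      [/\ forall x, `|V1 x| = `|x|, forall x, `|V2 x| = `|x| &
          forall x, `|W x| = `|x|],
      [/\ forall x, P1 (V1 x) = A1 (P1 x), forall x, P2 (V2 x) = A2 (P2 x) &
          forall x, P2 (W x) = B (P1 x)] &
      forall x, V2 (W x) = W (V1 x)].
Proof.
move=> cA1 cA2 cB BA.
have [K1 [J1 [P1 [V1 [J1n ad1 V1n PV1 _]]]]] := isometric_dilation cA1.
have P1le x : `|P1 x| <= `|x|.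
  by apply: (adjoint_contraction ad1) => h; rewrite J1n.
have [B' B'E] := boundedOp_comp B P1.
have cB' k : `|B' k| <= `|k| by rewrite B'E (le_trans (cB _)).
have B'V1 k : B' (V1 k) = A2 (B' k) by rewrite !B'E PV1 BA.
have [E [D BD]] := defect_operator cB'.
have [W0 W0c W0n2] := column_operator B' D.
have W0n k : `|W0 k| = `|k|.
  by apply: norm_eq_sqr; rewrite W0n2 BD.
set M := hilbert_sum (hcons H E) in W0 W0c W0n2 W0n *.
have [P0 P0c P0le] := first_coordinate H E.
have P0W0 k : P0 (W0 k) = B' k by rewrite P0c W0c.
have [AP APE] := boundedOp_comp A2 P0.
have cAP x : `|AP x| <= `|x| by rewrite APE (le_trans (cA2 _)).
have [F [D2 AD2]] := defect_operator cAP.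
have [S SE] := boundedOp_comp D2 W0.
have [DV DVE] := boundedOp_comp D V1.
(* Both squared norms are |k|^2 - |A2 (B' k)|^2. *)
have SDV k : `|DV k| = `|S k|.
  apply: norm_eq_sqr; apply: (addrI (`|A2 (B' k)| ^+ 2)).
  by rewrite SE DVE -{1}B'V1 BD -P0W0 -APE AD2 W0n V1n.
have [Gam GamS Gamle] : exists2 Gam : boundedOp F E,
    (forall k, Gam (S k) = DV k) & forall x, `|Gam x| <= `|x|.
  by apply: factorization => k; rewrite SDV.
have [GD GDE] := boundedOp_comp Gam D2.
have [T Tc Tn2] := column_operator AP GD.
have cT x : `|T x| <= `|x|.
  by rewrite -ler_sqr ?nnegrE// Tn2 -AD2 lerD2l GDE ler_sqr ?nnegrE.
have TW0 k : T (W0 k) = W0 (V1 k).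
  apply: dsumP => n; rewrite Tc W0c; case: n => [|[|n]] //=.
  - by rewrite APE P0W0 B'V1.
  - by rewrite GDE -SE GamS DVE.
have [K2 [J [P [V2 [Jn adJ V2n PV2 V2J]]]]] := isometric_dilation cT.
have [W WE] := boundedOp_comp J W0.
have [JH JHc JHn] := first_summand H E.
have adJH := first_summand_adjoint JHc P0c.
have [J2 J2E] := boundedOp_comp J JH.
have [P2 P2E] := boundedOp_comp P0 P.
have PJ := isometry_adjointK Jn adJ.
exists K1, K2, J1, P1, J2, P2, V1, V2, W; split.
- by [].
- split; first by move=> h; rewrite J2E Jn JHn.
  exact: is_adjoint_comp adJ adJH J2E P2E.
- by split=> // x; rewrite WE Jn W0n.
- split=> // x; first by rewrite !P2E PV2 P0c Tc /= APE.
  by rewrite P2E WE PJ P0W0 B'E.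
- move=> x; rewrite !WE -TW0; apply: V2J.
  by rewrite TW0 !W0n V1n.
Qed.

End Dilation.

(** * Co-isometric extensions *)

Theorem theorem7p4 (R : realType) (H : hilbertType R) (T1 T2 X : boundedOp H H)
    (cT1 : contractive T1) (cT2 : contractive T2) (cX : contractive X)
    (intertwine : forall h : H, T1 (X h) = X (T2 h)) :
  exists (K1 K2 : hilbertType R) (J1 : hilbertSub H K1) (J2 : hilbertSub H K2)
         (Z1 : boundedOp K1 K1) (Z2 : boundedOp K2 K2) (S : boundedOp K2 K1),
    [/\ is_extension J1 J1 T1 Z1 /\ coisometric Z1,
        is_extension J2 J2 T2 Z2 /\ coisometric Z2,
        is_extension J2 J1 X S /\ coisometric S &
        forall k : K2, Z1 (S k) = S (Z2 k)].
Proof.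
have [A1 adT1] := adjoint_exists T1.
have [A2 adT2] := adjoint_exists T2.
have [B adX] := adjoint_exists X.
have cA1 := adjoint_contraction adT1 (contractive_norm cT1).
have cA2 := adjoint_contraction adT2 (contractive_norm cT2).
have cB := adjoint_contraction adX (contractive_norm cX).
have BA h : B (A1 h) = A2 (B h).
  by apply: hdot_extr => x; rewrite -adX -adT1 -adT2 -adX intertwine.
have [K1 [K2 [J1 [P1 [J2 [P2 [V1 [V2 [W]]]]]]]]] :=
  isometric_intertwining cA1 cA2 cB BA.
move=> [[J1n ad1] [J2n ad2] [V1n V2n Wn] [PV1 PV2 PW] VW].
have [Z1 adV1] := adjoint_exists V1.
have [Z2 adV2] := adjoint_exists V2.
have [S adW] := adjoint_exists W.
have [Js1 Js1E] := hilbertSub_of_isometry J1n.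
have [Js2 Js2E] := hilbertSub_of_isometry J2n.
exists K1, K2, Js1, Js2, Z1, Z2, S; split.
- split; last exact: coisometric_adjoint V1n adV1.
  by move=> h; rewrite !Js1E; exact: (adjoint_extension ad1 ad1 adT1 adV1 PV1 h).
- split; last exact: coisometric_adjoint V2n adV2.
  by move=> h; rewrite !Js2E; exact: (adjoint_extension ad2 ad2 adT2 adV2 PV2 h).
- split; last exact: coisometric_adjoint Wn adW.
  by move=> h; rewrite Js2E Js1E; exact: (adjoint_extension ad1 ad2 adX adW PW h).
- move=> k; apply: hdot_extr => x.
  by rewrite -adV1 -adW -adW -adV2 VW.
Qed.
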